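(* Let $k$ be a field and let $(\mathcal R^{\bullet},d_0)$ be a $\mathbb Z_{\le 0}$-graded complex of $k$-vector spaces (with differential of degree $+1$) such that $H^{-1}(\mathcal R^\bullet,d_0)=0$ (with no assumption on $H^{-2},H^{-3},\dots$). (i) Put $\mathcal R^\bullet_\hbar=\mathcal R^\bullet\otimes k[\hbar]$. For $\ell=-1$ and $\ell=-2$ let $d^{(\ell)}_\hbar\colon\mathcal R^\ell_\hbar\to\mathcal R^{\ell+1}_\hbar$ be a $k[\hbar]$-linear map of the form $d_\hbar^{(\ell)}=d_0^{(\ell)}+\hbar d_1^{(\ell)}+\hbar^2d_2^{(\ell)}+\dots+\hbar^nd_n^{(\ell)}$ (a finite sum), such that $d_\hbar^{(-1)}\circ d_\hbar^{(-2)}=0$ as a map $\mathcal R_\hbar^{-2}\to\mathcal R_\hbar^0$. Let $\overline{\mathcal R}_\hbar$ be the complex $$0\to\mathcal R_\hbar^{-2}\xrightarrow{d_\hbar^{(-2)}}\mathcal R_\hbar^{-1}\xrightarrow{d_\hbar^{(-1)}}\mathcal R_\hbar^0\to0,$$ let $H^\ell_\hbar$ ($\ell=0,-1,-2$) be its cohomology, and let $$F_iH_\hbar^\ell=\mathrm{Im}\bigl(H^\ell(\hbar^i\overline{\mathcal R}_\hbar,d_\hbar)\to H^\ell(\overline{\mathcal R}_\hbar,d_\hbar)\bigr)$$ be the filtration on $H^\ell_\hbar$ induced by the filtration $\overline{\mathcal R}_\hbar\supset\hbar\overline{\mathcal R}_\hbar\supset\hbar^2\overline{\mathcal R}_\hbar\supset\dots$.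 Then for every $i\ge0$ there is a canonical isomorphism of $k[\hbar]$-modules $$F_iH_\hbar^0/F_{i+1}H_\hbar^0\;\xrightarrow{\ \sim\ }\;\hbar^iH^0(\mathcal R^\bullet,d_0).$$ (ii) The same statement holds with $k[\hbar]$ replaced by $k[[\hbar]]$, i.e. for $\mathcal R^\bullet_{[[\hbar]]}=\mathcal R^\bullet\otimes k[[\hbar]]$ and $k[[\hbar]]$-linear maps $d_\hbar^{(\ell)}=d_0^{(\ell)}+\hbar d_1^{(\ell)}+\hbar^2d_2^{(\ell)}+\dots$ ($\ell=-1,-2$), possibly infinite sums, with $d_\hbar^{(-1)}\circ d_\hbar^{(-2)}=0$.
   Context: $d_0^{(\ell)}\colon\mathcal R^\ell\to\mathcal R^{\ell+1}$ denotes the degree-$\ell$ component of the given differential $d_0$; the $d_m^{(\ell)}$, $m\ge 1$, are $k$-linear maps $\mathcal R^\ell\to\mathcal R^{\ell+1}$. All of them are extended $\hbar$-linearly. $\hbar^iH^0(\mathcal R^\bullet,d_0)$ denotes a copy of $H^0(\mathcal R^\bullet,d_0)=\mathcal R^0/d_0(\mathcal R^{-1})$, i.e. the degree-zero cohomology of $\hbar^i\overline{\mathcal R}_\hbar/\hbar^{i+1}\overline{\mathcal R}_\hbar$, on which $\hbar$ acts by zero. In (ii) the tensor product $\mathcal R^\bullet\otimes k[[\hbar]]$ is understood as $\hbar$-adically completed, i.e. $\mathcal R^\ell_{[[\hbar]]}=\mathcal R^\ell[[\hbar]]$ is the space of formal power series in $\hbar$ with coefficients in $\mathcal R^\ell$.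 *)

(* Defs.v *)
From HB Require Import structures.
From mathcomp Require Import all_boot all_algebra.
From mathcomp Require Import boolp functions.

Set Implicit Arguments.
Unset Strict Implicit.
Unset Printing Implicit Defensive.

Import GRing.Theory.
Local Open Scope ring_scope.
Local Open Scope quotient_scope.

Record submodule (A : nzRingType) (V : lmodType A) := Submodule {
  submodule_pred :> {pred V};
  submodule_closed : submod_closed submodule_pred
}.

HB.instance Definition _ (A : nzRingType) (V : lmodType A) (S : submodule V) :=
  GRing.isSubmodClosed.Build A V (submodule_pred S)
    (GRing.submod_closed_semi (submodule_closed S)).

Section SubmoduleType.
Variables (A : nzRingType) (V : lmodType A) (S : submodule V).

Record submod := Submod { submod_val : V; submod_mem : submod_val \in S }.

HB.instance Definition _ := [isSub for submod_val].
HB.instance Definition _ := [Choice of submod by <:].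
HB.instance Definition _ := [SubChoice_isSubLmodule of submod by <:].

End SubmoduleType.

Section SubmoduleMap.
Variables (A : nzRingType) (V W : lmodType A) (f : {linear V -> W}).
Variables (S : submodule V) (T : submodule W).
Hypothesis fST : forall x, x \in S -> f x \in T.

Definition submod_map (x : submod S) : submod T :=
  Submod (fST (submod_mem x)).

Fact submod_map_linear : linear submod_map.
Proof. by move=> a x y; apply: val_inj; rewrite /= !linearP. Qed.
HB.instance Definition _ :=
  GRing.isLinear.Build A (submod S) (submod T) _ submod_map submod_map_linear.

End SubmoduleMap.

Section Image.
Variables (A : nzRingType) (V W : lmodType A) (f : {linear V -> W}).

Definition image_pred : {pred W} := fun y => `[< exists x, y = f x >].

Fact image_closed : submod_closed image_pred.
Proof.
split=> [|a y z /asboolP[u ->] /asboolP[v ->]]; apply/asboolP.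
  by exists 0; rewrite linear0.
by exists (a *: u + v); rewrite linearP.
Qed.

Definition image_mod : submodule W := Submodule image_closed.

End Image.

Section Quotient.
Variables (A : nzRingType) (V : lmodType A) (S : submodule V).

Definition quotmod : Type := Quotient.quot S.
HB.instance Definition _ := GRing.Zmodule.on quotmod.

Definition quotmod_pi (x : V) : quotmod := \pi_(Quotient.quot S) x.

Lemma quotmod_piP x y : quotmod_pi x = quotmod_pi y <-> x - y \in S.
Proof. by rewrite Quotient.idealrBE; split=> [/eqP|/eqP]. Qed.

Lemma quotmod_piD : {morph quotmod_pi : x y / x + y}.
Proof. by move=> x y; rewrite /quotmod_pi; exact: (raddfD \pi_(Quotient.quot S)). Qed.

Lemma quotmod_pi_repr (q : quotmod) : quotmod_pi (repr (q : Quotient.quot S)) = q.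
Proof. exact: reprK. Qed.

Definition quotmod_scale (a : A) (q : quotmod) : quotmod :=
  quotmod_pi (a *: repr (q : Quotient.quot S)).

Lemma quotmod_scale_pi a x :
  quotmod_scale a (quotmod_pi x) = quotmod_pi (a *: x).
Proof.
apply/quotmod_piP; rewrite -scalerBr; apply: rpredZ.
by apply/quotmod_piP; rewrite quotmod_pi_repr.
Qed.

Fact quotmod_scaleA a b q :
  quotmod_scale a (quotmod_scale b q) = quotmod_scale (a * b) q.
Proof. by rewrite -[q]quotmod_pi_repr !quotmod_scale_pi scalerA. Qed.

Fact quotmod_scale1 : left_id 1 quotmod_scale.
Proof. by move=> q; rewrite -[q]quotmod_pi_repr quotmod_scale_pi scale1r. Qed.

Fact quotmod_scaleDr : right_distributive quotmod_scale +%R.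
Proof.
move=> a p q; rewrite -[p]quotmod_pi_repr -[q]quotmod_pi_repr.
by rewrite -quotmod_piD !quotmod_scale_pi scalerDr quotmod_piD.
Qed.

Fact quotmod_scaleDl q : {morph quotmod_scale^~ q : a b / a + b}.
Proof.
move=> a b; rewrite -[q]quotmod_pi_repr.
by rewrite !quotmod_scale_pi scalerDl quotmod_piD.
Qed.

HB.instance Definition _ := GRing.Zmodule_isLmodule.Build A quotmod
  quotmod_scaleA quotmod_scale1 quotmod_scaleDr quotmod_scaleDl.

Fact quotmod_pi_linear : linear quotmod_pi.
Proof. by move=> a x y; rewrite quotmod_piD -quotmod_scale_pi. Qed.
HB.instance Definition _ :=
  GRing.isLinear.Build A V quotmod _ quotmod_pi quotmod_pi_linear.

End Quotient.

(* [subquot S T] is S / (S :&: T); it is only used with T contained in S. *)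
Section Subquotient.
Variables (A : nzRingType) (V : lmodType A) (S T : submodule V).

Definition restr_pred : {pred submod S} := fun x => submod_val x \in T.

Fact restr_closed : submod_closed restr_pred.
Proof.
split=> [|a x y xT yT]; rewrite unfold_in /restr_pred.
  exact: rpred0.
by apply: rpredD => //; apply: rpredZ.
Qed.

Definition restr_mod : submodule (submod S) := Submodule restr_closed.

Definition subquot : lmodType A := quotmod restr_mod.

Definition subquot_pi : {linear submod S -> subquot} := quotmod_pi restr_mod.

End Subquotient.

(* Complexes concentrated in degrees <= 0 with differential of degree +1,
   indexed by the opposite of the degree: [X n] is the component of degree
   -n, and [diff X n] goes from degree -(n + 1) to degree -n. *)
Record complex (A : nzRingType) := Complex {
  obj :> nat -> lmodType A;
  diff : forall n, {linear obj n.+1 -> obj n};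
  diff_diff : forall n x, diff n (diff n.+1 x) = 0
}.
Arguments diff {A} X n : rename.

Section Cohomology.
Variables (A : nzRingType) (X : complex A).

Definition cocycle_pred (n : nat) : {pred X n} :=
  match n return {pred X n} with
  | 0 => predT
  | m.+1 => fun x => diff X m x == 0
  end.

Fact cocycle_closed n : submod_closed (@cocycle_pred n).
Proof.
case: n => [|n]; split=> //=; first by rewrite unfold_in /= linear0.
move=> a x y; rewrite !unfold_in /= => /eqP dx /eqP dy.
by rewrite linearP dx dy scaler0 addr0.
Qed.

Definition cocycles n : submodule (X n) := Submodule (@cocycle_closed n).

Definition coboundaries n : submodule (X n) := image_mod (diff X n).

(* [cohom n] is the cohomology in degree -n. *)
Definition cohom n : lmodType A := subquot (cocycles n) (coboundaries n).

Fact cocycles0 (x : X 0) : x \in cocycles 0.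
Proof. by []. Qed.

Definition class0 (x : X 0) : cohom 0 :=
  subquot_pi _ (coboundaries 0) (Submod (cocycles0 x)).

End Cohomology.
Arguments class0 {A} X x.

Record cmap (A : nzRingType) (X Y : complex A) := Cmap {
  cmap_fun :> forall n, {linear X n -> Y n};
  cmap_diff : forall n x, cmap_fun n (diff X n x) = diff Y n (cmap_fun n.+1 x)
}.

Section CohomologyMap.
Variables (A : nzRingType) (X Y : complex A) (f : cmap X Y) (n : nat).

Fact cmap_cocycles x : x \in cocycles X n -> f n x \in cocycles Y n.
Proof.
case: n x => [|m] x //; rewrite !unfold_in /= => /eqP dx.
by rewrite -cmap_diff dx linear0.
Qed.

Definition cohom_map (a : cohom X n) : cohom Y n :=
  subquot_pi _ (coboundaries Y n)
    (submod_map cmap_cocycles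
       (repr (a : Quotient.quot (restr_mod (cocycles X n) (coboundaries X n))))).

Lemma cohom_map_pi (z : submod (cocycles X n)) :
  cohom_map (subquot_pi _ (coboundaries X n) z) =
  subquot_pi _ (coboundaries Y n) (submod_map cmap_cocycles z).
Proof.
apply/quotmod_piP; rewrite -linearB unfold_in /= /restr_pred /=.
set r := repr _.
have : r - z \in restr_mod (cocycles X n) (coboundaries X n).
  by apply/quotmod_piP; rewrite quotmod_pi_repr.
rewrite unfold_in => /asboolP[y /= yE]; apply/asboolP.
by exists (f n.+1 y); rewrite -cmap_diff -yE.
Qed.

Fact cohom_map_linear : linear cohom_map.
Proof.
move=> a p q; rewrite -[p]quotmod_pi_repr -[q]quotmod_pi_repr.
set u := repr _; set v := repr _.
have -> : a *: quotmod_pi _ u + quotmod_pi _ v =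
  subquot_pi _ (coboundaries X n) (a *: u + v) by rewrite linearP.
by rewrite cohom_map_pi !(cohom_map_pi u, cohom_map_pi v) !linearP.
Qed.
HB.instance Definition _ :=
  GRing.isLinear.Build A (cohom X n) (cohom Y n) _ cohom_map cohom_map_linear.

End CohomologyMap.

Section Filtration.
Variables (A : comNzRingType) (h : A).

Definition hpow_pred (V : lmodType A) (i : nat) : {pred V} :=
  fun x => `[< exists y, x = h ^+ i *: y >].

Fact hpow_closed V i : submod_closed (@hpow_pred V i).
Proof.
split=> [|a y z /asboolP[u ->] /asboolP[v ->]]; apply/asboolP.
  by exists 0; rewrite scaler0.
by exists (a *: u + v); rewrite scalerDr !scalerA mulrC.
Qed.

Definition hpow V i : submodule V := Submodule (@hpow_closed V i).

Variables (X : complex A) (i : nat).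

Fact hpow_diff n x : x \in hpow (X n.+1) i -> diff X n x \in hpow (X n) i.
Proof. by move=> /asboolP[y ->]; apply/asboolP; exists (diff X n y); rewrite linearZ. Qed.

Fact hsub_diff_diff n x :
  submod_map (@hpow_diff n) (submod_map (@hpow_diff n.+1) x) = 0.
Proof. by apply: val_inj; rewrite /= diff_diff. Qed.

Definition hsub : complex A :=
  @Complex A (fun n => submod (hpow (X n) i))
    (fun n => submod_map (@hpow_diff n)) hsub_diff_diff.

Definition hsub_incl : cmap hsub X :=
  @Cmap A hsub X (fun n => \val : {linear submod (hpow (X n) i) -> X n})
    (fun _ _ => erefl).

(* F_i H^{-n}(X) *)
Definition filt n : submodule (cohom X n) := image_mod (@cohom_map _ _ _ hsub_incl n).

End Filtration.

Section ThreeTerm.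
Variables (A : nzRingType) (M2 M1 M0 : lmodType A).
Variables (d2 : {linear M2 -> M1}) (d1 : {linear M1 -> M0}).
Hypothesis dd : forall x, d1 (d2 x) = 0.

Definition three_term_obj (n : nat) : lmodType A :=
  match n with 0 => M0 | 1 => M1 | 2 => M2 | _ => 'rV[A]_0 end.

Definition three_term_diff (n : nat) :
    {linear three_term_obj n.+1 -> three_term_obj n} :=
  match n return {linear three_term_obj n.+1 -> three_term_obj n} with
  | 0 => d1
  | 1 => d2
  | 2 => \0
  | _ => \0
  end.

Fact three_term_diff_diff n x :
  three_term_diff n (three_term_diff n.+1 x) = 0.
Proof. by case: n x => [|[|[|n]]] x //=; rewrite linear0. Qed.

(* 0 -> M2 -> M1 -> M0 -> 0 with M0 in degree 0 *)
Definition three_term : complex A := Complex three_term_diff_diff.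

End ThreeTerm.

Section Cauchy.
Variables (k : comNzRingType) (V : lmodType k).
Implicit Types (a b : nat -> k) (x y : nat -> V).

Definition cauchy a x : nat -> V := fun m => \sum_(j < m.+1) a j *: x (m - j)%N.

Lemma cauchy_rev a x m : cauchy a x m = \sum_(j < m.+1) a (m - j)%N *: x j.
Proof.
rewrite /cauchy (reindex_inj rev_ord_inj) /=.
by apply: eq_bigr => j _; rewrite subSS subKn // -ltnS.
Qed.

Lemma cauchyA a b x :
  cauchy a (cauchy b x) =
  cauchy (fun m => \sum_(j < m.+1) a j * b (m - j)%N) x.
Proof.
apply/funext => m; rewrite [RHS]cauchy_rev.
pose F j l := (a j * b (m - j - l)%N) *: x l.
transitivity (\sum_(j < m.+1) \sum_(l < m.+1 | (l <= m - j)%N) F j l).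
  apply: eq_bigr => j _; rewrite cauchy_rev scaler_sumr.
  rewrite (big_ord_narrow_leq (leq_subr _ _)) /=.
  by apply: eq_bigr => l _; rewrite scalerA.
rewrite (exchange_big_dep predT) //=; apply: eq_bigr => l _.
transitivity (\sum_(j < m.+1 | (j <= m - l)%N) F j l).
  apply: eq_bigl => j; rewrite -ltnS -(ltnS j) -!subSn ?leq_ord //.
  by rewrite -subn_gt0 -(subn_gt0 j) -!subnDA addnC.
rewrite (big_ord_narrow_leq (leq_subr _ _)) scaler_suml.
by apply: eq_bigr => j _; rewrite /F -!subnDA addnC.
Qed.

Lemma cauchyDr a x y : cauchy a (x \+ y) = cauchy a x \+ cauchy a y.
Proof.
apply/funext => m; rewrite /cauchy /= -big_split.
by apply: eq_bigr => j _; rewrite /= scalerDr.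
Qed.

Lemma cauchyDl a b x : cauchy (a \+ b) x = cauchy a x \+ cauchy b x.
Proof.
apply/funext => m; rewrite /cauchy /= -big_split.
by apply: eq_bigr => j _; rewrite /= scalerDl.
Qed.

Lemma cauchy1 x : cauchy (fun j => (j == 0)%:R) x = x.
Proof.
apply/funext => m; rewrite /cauchy big_ord_recl /= scale1r subn0 big1 ?addr0 //.
by move=> j _; rewrite scale0r.
Qed.

End Cauchy.

(* k[[h]]: a power series is the function of its coefficients. *)
Definition fps (k : comNzRingType) : Type := nat -> k.

Section PowerSeries.
Variable k : comNzRingType.
Implicit Types a b c : fps k.

HB.instance Definition _ := GRing.Zmodule.copy (fps k) (nat -> k).

Definition fps_one : fps k := fun j => (j == 0)%:R.
Definition fps_mul a b : fps k := fun m => \sum_(j < m.+1) a j * b (m - j)%N.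

Fact fps_mulA : associative fps_mul.
Proof. by move=> a b c; exact: (@cauchyA k k^o a b c). Qed.

Fact fps_mulC : commutative fps_mul.
Proof.
move=> a b; apply/funext => m; rewrite [LHS](@cauchy_rev k k^o a b m).
by apply: eq_bigr => j _; rewrite mulrC.
Qed.

Fact fps_mul1 : left_id fps_one fps_mul.
Proof. exact: (@cauchy1 k k^o). Qed.

Fact fps_mulDl : left_distributive fps_mul +%R.
Proof. by move=> a b c; exact: (@cauchyDl k k^o a b c). Qed.

Fact fps_one_neq0 : fps_one != 0.
Proof.
apply/eqP => /(congr1 (fun a : fps k => a 0%N)) /eqP.
by rewrite /fps_one /= oner_eq0.
Qed.

HB.instance Definition _ := GRing.Zmodule_isComNzRing.Build (fps k)
  fps_mulA fps_mulC fps_mul1 fps_mulDl fps_one_neq0.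

Definition fps_var : fps k := fun j => (j == 1)%:R.

Definition fps_coef0 a : k := a 0%N.

Fact fps_coef0_zmod_morphism : zmod_morphism fps_coef0.
Proof. by []. Qed.
HB.instance Definition _ :=
  GRing.isZmodMorphism.Build (fps k) k fps_coef0 fps_coef0_zmod_morphism.

Fact fps_coef0_monoid_morphism : monoid_morphism fps_coef0.
Proof. by split=> // a b; rewrite /fps_coef0 [LHS]big_ord1. Qed.
HB.instance Definition _ :=
  GRing.isMonoidMorphism.Build (fps k) k fps_coef0 fps_coef0_monoid_morphism.

End PowerSeries.

(* V[[h]] *)
Definition hser (k : comNzRingType) (V : lmodType k) : Type := nat -> V.

Section SeriesModule.
Variables (k : comNzRingType) (V : lmodType k).

HB.instance Definition _ := GRing.Zmodule.copy (hser V) (nat -> V).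

Definition hser_scale (a : fps k) (x : hser V) : hser V := cauchy a x.

Fact hser_scaleA a b x : hser_scale a (hser_scale b x) = hser_scale (a * b) x.
Proof. exact: cauchyA. Qed.

Fact hser_scale1 : left_id 1 hser_scale.
Proof. exact: cauchy1. Qed.

Fact hser_scaleDr : right_distributive hser_scale +%R.
Proof. by move=> a x y; exact: cauchyDr. Qed.

Fact hser_scaleDl x : {morph hser_scale^~ x : a b / a + b}.
Proof. by move=> a b; exact: cauchyDl. Qed.

HB.instance Definition _ := GRing.Zmodule_isLmodule.Build (fps k) (hser V)
  hser_scaleA hser_scale1 hser_scaleDr hser_scaleDl.

End SeriesModule.

(* V (x) k[h], realised as V[h]: finitely supported sequences of coefficients *)
Section PolynomialModule.
Variables (k : comNzRingType) (V : lmodType k).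

Definition finsupp : {pred nat -> V} :=
  fun x => `[< exists N, forall m, (N <= m)%N -> x m = 0 >].

Record hpoly := Hpoly { hpoly_coef :> nat -> V; hpoly_fin : hpoly_coef \in finsupp }.

HB.instance Definition _ := [isSub for hpoly_coef].
HB.instance Definition _ := [Choice of hpoly by <:].

Fact finsupp_closed : zmod_closed finsupp.
Proof.
split=> [|x y /asboolP[M xM] /asboolP[N yN]]; apply/asboolP.
  by exists 0%N.
exists (maxn M N) => m; rewrite geq_max => /andP[Mm Nm].
by rewrite [LHS](_ : _ = x m - y m) // xM // yN // subr0.
Qed.
HB.instance Definition _ := GRing.isZmodClosed.Build (nat -> V) finsupp finsupp_closed.
HB.instance Definition _ := [SubChoice_isSubZmodule of hpoly by <:].

Fact cauchy_finsupp (p : {poly k}) (x : hpoly) :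
  cauchy (fun j => p`_j) x \in finsupp.
Proof.
have /asboolP[N xN] := hpoly_fin x; apply/asboolP; exists (size p + N)%N => m pNm.
rewrite /cauchy big1 // => j _; have [pj|jp] := leqP (size p) j.
  by rewrite nth_default ?scale0r.
rewrite xN ?scaler0 //; apply: leq_trans (leq_sub2r j pNm).
by rewrite -addnBAC ?leq_addl // ltnW.
Qed.

Definition hpoly_scale (p : {poly k}) (x : hpoly) : hpoly :=
  Hpoly (cauchy_finsupp p x).

Fact hpoly_scaleA p q x : hpoly_scale p (hpoly_scale q x) = hpoly_scale (p * q) x.
Proof.
apply: val_inj; rewrite /= cauchyA; congr cauchy.
by apply/funext => m; rewrite coefM.
Qed.

Fact hpoly_scale1 : left_id 1 hpoly_scale.
Proof.
move=> x; apply: val_inj; rewrite /= -[RHS]cauchy1; congr cauchy.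
by apply/funext => m; rewrite coef1.
Qed.

Fact hpoly_scaleDr : right_distributive hpoly_scale +%R.
Proof. by move=> p x y; apply: val_inj; exact: cauchyDr. Qed.

Fact hpoly_scaleDl x : {morph hpoly_scale^~ x : p q / p + q}.
Proof.
move=> p q; apply: val_inj; rewrite /= [RHS](esym (cauchyDl _ _ _)).
by congr cauchy; apply/funext => m; rewrite coefD.
Qed.

HB.instance Definition _ := GRing.Zmodule_isLmodule.Build {poly k} hpoly
  hpoly_scaleA hpoly_scale1 hpoly_scaleDr hpoly_scaleDl.

End PolynomialModule.

(* k-linear maps extended h-linearly *)
Section PolynomialMap.
Variables (k : comNzRingType) (V W : lmodType k) (f : {linear V -> W}).

Fact hpoly_map_fin (x : hpoly V) : (fun m => f (x m)) \in @finsupp k W.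
Proof.
have /asboolP[N xN] := hpoly_fin x; apply/asboolP; exists N => m Nm.
by rewrite xN // linear0.
Qed.

Definition hpoly_map (x : hpoly V) : hpoly W := Hpoly (hpoly_map_fin x).

End PolynomialMap.

(* A k-module viewed as an A-module through eps : A -> k. For A = k[h] or
   k[[h]] and eps the constant coefficient, h acts by zero. *)
Definition restr_scalars (A k : comNzRingType) (eps : {rmorphism A -> k})
  (V : lmodType k) : Type := V.

Section RestrScalars.
Variables (A k : comNzRingType) (eps : {rmorphism A -> k}) (V : lmodType k).

HB.instance Definition _ := GRing.Zmodule.copy (restr_scalars eps V) V.

Definition restr_scalars_scale (a : A) (v : restr_scalars eps V) : restr_scalars eps V :=
  eps a *: (v : V).

Fact restr_scalars_scaleA a b v :
  restr_scalars_scale a (restr_scalars_scale b v) = restr_scalars_scale (a * b) v.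
Proof. by rewrite /restr_scalars_scale scalerA rmorphM. Qed.

Fact restr_scalars_scale1 : left_id 1 restr_scalars_scale.
Proof. by move=> v; rewrite /restr_scalars_scale rmorph1 scale1r. Qed.

Fact restr_scalars_scaleDr : right_distributive restr_scalars_scale +%R.
Proof. by move=> a u v; exact: scalerDr. Qed.

Fact restr_scalars_scaleDl v : {morph restr_scalars_scale^~ v : a b / a + b}.
Proof. by move=> a b; rewrite /restr_scalars_scale rmorphD scalerDl. Qed.

HB.instance Definition _ := GRing.Zmodule_isLmodule.Build A (restr_scalars eps V)
  restr_scalars_scaleA restr_scalars_scale1 restr_scalars_scaleDr restr_scalars_scaleDl.

End RestrScalars.

(* Main.v *)
(* If D w is divisible by h^i, then D w = h^i z with z_0 a coboundary of d_0:
   for i > 0 the constant term w_0 is a d_0-cocycle, hence w_0 = d_0 v because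
   H^{-1} = 0, and replacing w by w - D v, which is divisible by h, does not
   change D w since D D = 0; divide by h and induct on i. This makes the leading
   coefficient map [h^i x] |-> [x_0] well defined on F_i / F_{i+1}. Only the
   regularity of h and the reduction modulo h enter, so the same argument covers
   k[h] and k[[h]]. *)
Require Import Defs.
From HB Require Import structures.
From mathcomp Require Import all_boot all_algebra.
From mathcomp Require Import boolp functions.
Import GRing.Theory.
Local Open Scope ring_scope.

Set Implicit Arguments.
Unset Strict Implicit.
Unset Printing Implicit Defensive.

(** * Degree-zero classes and explicit representatives for the filtration *)

Section Class0.
Variables (A : nzRingType) (X : complex A).

Lemma class0_linear : linear (@class0 A X).
Proof.
by move=> a x y; rewrite /class0 -linearP; congr (subquot_pi _ _ _); apply: val_inj.
Qed.

HB.instance Definition _ :=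
  GRing.isLinear.Build A (X 0) (cohom X 0) _ (@class0 A X) class0_linear.

Lemma class0_surj (a : cohom X 0) : exists x, a = class0 X x.
Proof.
rewrite -[a]quotmod_pi_repr; set u := repr _; exists (submod_val u).
by congr (quotmod_pi _ _); apply: val_inj.
Qed.

Lemma class0_eq0 x : class0 X x = 0 <-> exists w, x = diff X 0 w.
Proof.
rewrite -(linear0 (@class0 A X)) /class0; split=> [/quotmod_piP|[w ->]].
  by rewrite unfold_in /restr_pred /= subr0 => /asboolP.
apply/quotmod_piP; rewrite unfold_in /restr_pred /= subr0.
by apply/asboolP; exists w.
Qed.

End Class0.

(** In degree 0 every element is a cocycle, so a class coming from [hsub h X i] is represented by
    any multiple of [h ^+ i], and conversely. *)
Lemma filt0P (A : comNzRingType) (h : A) (X : complex A) i (a : cohom X 0) :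
  a \in filt h X i 0 <-> exists x, a = class0 X (h ^+ i *: x).
Proof.
split=> [/asboolP[b ->]|[x ->]].
  have [[z zi] ->] := class0_surj b.
  have /asboolP[x zE] := zi; exists x.
  by rewrite [LHS]cohom_map_pi; congr (subquot_pi _ _ _); apply: val_inj.
have xi : h ^+ i *: x \in hpow h (X 0) i by apply/asboolP; exists x.
apply/asboolP; exists (class0 (hsub h X i) (Submod xi)).
by rewrite [RHS]cohom_map_pi; congr (subquot_pi _ _ _); apply: val_inj.
Qed.

Lemma cohom1_eq0 (A : nzRingType) (X : complex A) :
  (forall a : cohom X 1, a = 0) ->
  forall x, diff X 0 x = 0 -> exists y, x = diff X 1 y.
Proof.
move=> HX x dx; have xZ : x \in cocycles X 1 by rewrite unfold_in /= dx.
have := HX (subquot_pi _ (coboundaries X 1) (Submod xZ)).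
rewrite -(linear0 (subquot_pi _ (coboundaries X 1))) => /quotmod_piP.
by rewrite unfold_in /restr_pred /= subr0 => /asboolP.
Qed.

(* For linear [c] and [eps h = 0], the kernel of [c] is then exactly [h M]. *)
Definition reduction_mod (A k : comNzRingType) (eps : {rmorphism A -> k}) (h : A)
    (M : lmodType A) (V : lmodType k) (c : M -> restr_scalars eps V) :=
  (forall v, exists x, c x = v) /\ (forall x, c x = 0 -> exists y, x = h *: y).

(** * The leading-coefficient isomorphism for a regular [h] and an abstract reduction modulo [h] *)

Section GradedIso.
Variables (A k : comNzRingType) (eps : {rmorphism A -> k}) (h : A).
Variables (X : complex A) (R : complex k).
Variables (c0 : {linear X 0 -> restr_scalars eps (R 0)}).
Variables (c1 : {linear X 1 -> restr_scalars eps (R 1)}).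
Variables (c2 : {linear X 2 -> restr_scalars eps (R 2)}).
Hypothesis eps_h : eps h = 0.
Hypothesis h_reg : forall x : X 0, h *: x = 0 -> x = 0.
Hypothesis red0 : reduction_mod h c0.
Hypothesis red1 : reduction_mod h c1.
Hypothesis red2 : reduction_mod h c2.
Hypothesis c0_diff : forall w, c0 (diff X 0 w) = diff R 0 (c1 w).
Hypothesis c1_diff : forall w, c1 (diff X 1 w) = diff R 1 (c2 w).
Hypothesis HR : forall a : cohom R 1, a = 0.

Lemma reduction_scale (M : lmodType A) (V : lmodType k)
  (c : {linear M -> restr_scalars eps V}) x : c (h *: x) = 0.
Proof. by rewrite linearZ /= [LHS](_ : _ = eps h *: (c x : V)) // eps_h scale0r. Qed.

Lemma hX_reg i (x y : X 0) : h ^+ i *: x = h ^+ i *: y -> x = y.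
Proof.
elim: i => [|i IHi]; first by rewrite expr0 !scale1r.
rewrite exprS -!scalerA => /eqP; rewrite -subr_eq0 -scalerBr => /eqP/h_reg/eqP.
by rewrite subr_eq0 => /eqP/IHi.
Qed.

Lemma leading_coboundary i (z : X 0) w :
  h ^+ i *: z = diff X 0 w -> exists v, c0 z = diff R 0 v.
Proof.
(* The element [w] stays general because the induction replaces it by [w'], where
   [w - D v = h w']. *)
elim: i w => [|i IHi] w; first by rewrite scale1r => ->; exists (c1 w).
move=> zE; have dw0 : diff R 0 (c1 w) = 0.
  by rewrite -c0_diff -zE exprS -scalerA reduction_scale.
(* Vanishing of H^{-1} gives a primitive [v0] of [c1 w]; it is lifted to [X 2] so that [D v] has the
   same reduction as [w]. *)
have [v0 wE] := cohom1_eq0 HR dw0; have [v vE] := red2.1 v0.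
have [|w' w'E] := red1.2 (w - diff X 1 v).
  by rewrite linearB /= c1_diff vE [c1 w]wE subrr.
(* One factor [h] cancels from [h^(i+1) z = D w = D (w - D v) = h D w']. *)
apply: (IHi w'); apply: (hX_reg (i := 1)).
by rewrite scalerA -exprS zE -linearZ -w'E linearB /= diff_diff subr0.
Qed.

(** Left to right yields well-definedness of the leading class, right to left its injectivity. Only
    the first direction goes through [leading_coboundary]. *)
Lemma leading_class_eq0 i (x : X 0) :
  (class0 X (h ^+ i *: x) \in filt h X i.+1 0) <-> class0 R (c0 x) = 0.
Proof.
split=> [/filt0P[y] xy|/class0_eq0[v xE]].
  (* Subtracting [h y] makes the class vanish without changing the constant term of [x]. *)
  have /class0_eq0[w] : class0 X (h ^+ i *: (x - h *: y)) = 0.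
    by rewrite scalerBr scalerA -exprSr linearB /= xy subrr.
  move/leading_coboundary => [v]; rewrite linearB /= reduction_scale subr0 => ->.
  by apply/class0_eq0; exists v.
(* With [w] lifting [v], the difference [x - D w] reduces to 0, hence equals [h y]; then [h^i x] and
   [h^(i+1) y] differ by the coboundary [h^i D w]. *)
have [w wE] := red1.1 v.
have [|y yE] := red0.2 (x - diff X 0 w).
  by rewrite linearB /= c0_diff wE [c0 x]xE subrr.
apply/filt0P; exists y; rewrite exprSr -scalerA -yE scalerBr linearB /=.
have /class0_eq0 dw0 : exists w', diff X 0 (h ^+ i *: w) = diff X 0 w'.
  by exists (h ^+ i *: w).
by rewrite -linearZ dw0 subr0.
Qed.

Section LeadingClass.
Variable i : nat.
Local Notation F := (fun i => filt h X i 0).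

Lemma filt_lift (u : submod (F i)) : exists x, val u = class0 X (h ^+ i *: x).
Proof. exact/filt0P/submod_mem. Qed.

(** Both the representative of [q] and its lift [x] are arbitrary choices; [leading_classE] removes
    the dependence on them. *)
Definition leading_class (q : subquot (F i) (F i.+1)) :
    restr_scalars eps (cohom R 0) :=
  class0 R (c0 (projT1 (cid (filt_lift
    (repr (q : Quotient.quot (restr_mod (F i) (F i.+1)))))))).

(** Two lifts [y] and [x] of the same graded class satisfy [[h^i (y - x)]] in [F i.+1], so
    [leading_class_eq0] kills the class of [c0 (y - x)]. *)
Lemma leading_classE (x : X 0) (u : submod (F i)) :
  val u = class0 X (h ^+ i *: x) ->
  leading_class (subquot_pi (F i) (F i.+1) u) = class0 R (c0 x).
Proof.
move=> uE; rewrite /leading_class; case: cid => y /= yE.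
suff /(leading_class_eq0 i) : class0 X (h ^+ i *: (y - x)) \in F i.+1.
  rewrite linearB /= => yx; apply: (@subr0_eq (cohom R 0)).
  by rewrite -linearB.
rewrite scalerBr linearB /= -uE -yE.
set q := quotmod_pi _ u.
have : repr (q : Quotient.quot _) - u \in restr_mod (F i) (F i.+1).
  by apply/quotmod_piP; rewrite quotmod_pi_repr.
by rewrite unfold_in.
Qed.

Lemma leading_class_linear : linear leading_class.
Proof.
move=> a p q; rewrite -[p]quotmod_pi_repr -[q]quotmod_pi_repr.
set u := repr _; set v := repr _.
have [x xE] := filt_lift u; have [y yE] := filt_lift v.
rewrite [leading_class (quotmod_pi _ u)](leading_classE xE).
rewrite [leading_class (quotmod_pi _ v)](leading_classE yE) -linearP.
rewrite (@leading_classE (a *: x + y)).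
  by rewrite linearP [LHS](linearP (@class0 k R)).
rewrite scalerDr scalerA mulrC -scalerA.
by rewrite [LHS]linearP [RHS]linearP; congr (_ *: _ + _).
Qed.

HB.instance Definition _ := GRing.isLinear.Build A (subquot (F i) (F i.+1))
  (restr_scalars eps (cohom R 0)) _ leading_class leading_class_linear.

Lemma leading_class_bij : bijective leading_class.
Proof.
have surj v : exists q, leading_class q = v.
  have [r ->] := class0_surj v; have [x <-] := red0.1 r.
  have xF : class0 X (h ^+ i *: x) \in F i by apply/filt0P; exists x.
  exists (subquot_pi (F i) (F i.+1) (Submod xF)); exact: leading_classE.
have inj : injective leading_class.
  apply: raddf_inj => q; rewrite -[q]quotmod_pi_repr; set u := repr _.
  have [x xE] := filt_lift u.
  move=> /(etrans (esym (leading_classE xE)))/(leading_class_eq0 i).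
  rewrite -xE -(linear0 (quotmod_pi _)) => uF; apply/quotmod_piP.
  by rewrite subr0 unfold_in.
(* [bijective] asks for an inverse: choice gives a section, and injectivity makes it two-sided. *)
have [g gK] := choice surj.
by exists g => [q|//]; apply: inj.
Qed.

(** The second clause expresses canonicity: by [filt_lift] every [u] has the form required there, so
    the formula determines [phi]. *)
Lemma graded_iso : exists phi : {linear subquot (F i) (F i.+1) ->
                         restr_scalars eps (cohom R 0)},
  bijective phi /\
  forall (x : X 0) (u : submod (F i)), val u = class0 X (h ^+ i *: x) ->
    phi (subquot_pi (F i) (F i.+1) u) = class0 R (c0 x).
Proof. exists leading_class; split; [exact: leading_class_bij|exact: leading_classE]. Qed.

End LeadingClass.
End GradedIso.

(** * Reduction modulo [h] for V[h] and V[[h]], where [h] shifts coefficients *)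

Lemma cauchy_var (k : comNzRingType) (V : lmodType k) (x : nat -> V) m :
  cauchy (fun j => (j == 1)%:R) x m = if m is m'.+1 then x m' else 0.
Proof.
rewrite /cauchy; case: m => [|m]; first by rewrite big_ord1 scale0r.
rewrite 2!big_ord_recl scale0r add0r scale1r big1 ?addr0; first by congr x; exact: subn1.
by move=> j _; rewrite scale0r.
Qed.

Section PolynomialReduction.
Variables (k : comNzRingType) (V : lmodType k).

Definition hpoly_coef0 (x : hpoly V) : restr_scalars (horner_eval (0 : k)) V := x 0%N.

Fact hpoly_coef0_linear : linear hpoly_coef0.
Proof.
move=> p x y; rewrite /hpoly_coef0 [LHS](_ : _ = cauchy (fun j => p`_j) x 0 + y 0%N) //.
by congr (_ + _); rewrite /cauchy big_ord1 -horner_coef0.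
Qed.

HB.instance Definition _ := GRing.isLinear.Build {poly k} (hpoly V)
  (restr_scalars (horner_eval (0 : k)) V) _ hpoly_coef0 hpoly_coef0_linear.

Lemma coef_scaleX (x : hpoly V) m : ('X *: x) m = if m is m'.+1 then x m' else 0.
Proof.
rewrite -cauchy_var [LHS](_ : _ = cauchy (fun j => 'X`_j) x m) //.
by congr cauchy; apply/funext => j; rewrite coefX.
Qed.

Lemma hpoly_scaleX_reg (x : hpoly V) : 'X *: x = 0 -> x = 0.
Proof.
move=> Xx; apply/val_inj/funext => m /=.
by have /(congr1 (fun y : hpoly V => y m.+1)) := Xx; rewrite coef_scaleX.
Qed.

(** Constants lift the values of [hpoly_coef0]; division by ['X] is the downward shift, which keeps
    the support finite. *)
Lemma hpoly_reduction : reduction_mod 'X hpoly_coef0.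
Proof.
split=> [v|x x0].
  have v_fin : (fun m => if m is 0 then v else 0) \in @finsupp k V.
    by apply/asboolP; exists 1%N; case.
  by exists (@Hpoly k V _ v_fin).
have shift_fin : (fun m => x m.+1) \in @finsupp k V.
  have /asboolP[N xN] := hpoly_fin x.
  by apply/asboolP; exists N => m Nm; rewrite xN // ltnW.
by exists (Hpoly shift_fin); apply/val_inj/funext => m; rewrite [RHS]coef_scaleX; case: m.
Qed.

End PolynomialReduction.

Lemma hpoly_coef0_perturbation (k : comNzRingType) (V W : lmodType k)
    (f : {linear V -> W}) (g : nat -> {linear V -> W}) n (x : hpoly V) :
  hpoly_coef0 (hpoly_map f x + \sum_(1 <= j < n.+1) 'X^j *: hpoly_map (g j) x) =
  f (hpoly_coef0 x).
Proof.
pose c : {linear hpoly W -> restr_scalars (horner_eval (0 : k)) W} :=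
  @hpoly_coef0 k W.
(* Shifting the index turns each exponent into a successor, which exposes a factor ['X] that the
   reduction kills. *)
rewrite -[LHS]/(c _) linearD linear_sum big_add1 big1 ?addr0 // => j _.
by rewrite exprS -scalerA reduction_scale; last exact: hornerX.
Qed.

Section SeriesReduction.
Variables (k : comNzRingType) (V : lmodType k).

Definition hser_coef0 (x : hser V) : restr_scalars (@fps_coef0 k) V := x 0%N.

Fact hser_coef0_linear : linear hser_coef0.
Proof.
move=> p x y; rewrite /hser_coef0 [LHS](_ : _ = cauchy p x 0 + y 0%N) //.
by congr (_ + _); rewrite /cauchy big_ord1.
Qed.

HB.instance Definition _ := GRing.isLinear.Build (fps k) (hser V)
  (restr_scalars (@fps_coef0 k) V) _ hser_coef0 hser_coef0_linear.

Lemma coef_scale_fps_var (x : hser V) m :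
  (fps_var k *: x) m = if m is m'.+1 then x m' else 0.
Proof. exact: cauchy_var. Qed.

Lemma hser_scale_var_reg (x : hser V) : fps_var k *: x = 0 -> x = 0.
Proof.
move=> hx; apply/funext => m.
by have /(congr1 (fun y : hser V => y m.+1)) := hx; rewrite coef_scale_fps_var.
Qed.

Lemma hser_reduction : reduction_mod (fps_var k) hser_coef0.
Proof.
split=> [v|x x0]; first by exists (fun m => if m is 0 then v else 0).
by exists (fun m => x m.+1); apply/funext => m; rewrite [RHS]coef_scale_fps_var; case: m.
Qed.

End SeriesReduction.

Theorem theorem2p3 (k : fieldType) (R : complex k)
    (HR : forall a : cohom R 1, a = 0) :
  (forall (n1 n2 : nat)
      (d1 : nat -> {linear R 1 -> R 0}) (d2 : nat -> {linear R 2 -> R 1})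
      (D1 : {linear hpoly (R 1) -> hpoly (R 0)})
      (D2 : {linear hpoly (R 2) -> hpoly (R 1)})
      (D1E : forall x, D1 x = hpoly_map (diff R 0) x
                              + \sum_(1 <= j < n1.+1) 'X^j *: hpoly_map (d1 j) x)
      (D2E : forall x, D2 x = hpoly_map (diff R 1) x
                              + \sum_(1 <= j < n2.+1) 'X^j *: hpoly_map (d2 j) x)
      (DD : forall x, D1 (D2 x) = 0) (i : nat),
    let F := fun i => filt 'X (three_term DD) i 0 in
    exists phi : {linear subquot (F i) (F i.+1) ->
                         restr_scalars (horner_eval (0 : k)) (cohom R 0)},
      bijective phi /\
      forall (x : hpoly (R 0)) (u : submod (F i)),
        val u = class0 (three_term DD) ('X^i *: x) ->
        phi (subquot_pi (F i) (F i.+1) u) = class0 R (x 0)) /\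
  (forall (d1 : nat -> {linear R 1 -> R 0}) (d2 : nat -> {linear R 2 -> R 1})
      (D1 : {linear hser (R 1) -> hser (R 0)})
      (D2 : {linear hser (R 2) -> hser (R 1)})
      (D1E : forall x m, D1 x m = diff R 0 (x m)
                              + \sum_(1 <= j < m.+1) d1 j (x (m - j)%N))
      (D2E : forall x m, D2 x m = diff R 1 (x m)
                              + \sum_(1 <= j < m.+1) d2 j (x (m - j)%N))
      (DD : forall x, D1 (D2 x) = 0) (i : nat),
    let F := fun i => filt (fps_var k) (three_term DD) i 0 in
    exists phi : {linear subquot (F i) (F i.+1) ->
                         restr_scalars (@fps_coef0 k) (cohom R 0)},
      bijective phi /\
      forall (x : hser (R 0)) (u : submod (F i)),
        val u = class0 (three_term DD) (fps_var k ^+ i *: x) ->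
        phi (subquot_pi (F i) (F i.+1) u) = class0 R (x 0)).
Proof.
split=> [n1 n2 d1 d2 D1 D2 D1E D2E DD i F|d1 d2 D1 D2 D1E D2E DD i F].
  apply: (@graded_iso _ _ _ 'X (three_term DD) R (@hpoly_coef0 k (R 0))
    (@hpoly_coef0 k (R 1)) (@hpoly_coef0 k (R 2))) => //.
  - exact: hornerX.
  - exact: hpoly_scaleX_reg.
  - exact: hpoly_reduction.
  - exact: hpoly_reduction.
  - exact: hpoly_reduction.
  - by move=> w; rewrite /= D1E hpoly_coef0_perturbation.
  - by move=> w; rewrite /= D2E hpoly_coef0_perturbation.
apply: (@graded_iso _ _ _ (fps_var k) (three_term DD) R (@hser_coef0 k (R 0))
  (@hser_coef0 k (R 1)) (@hser_coef0 k (R 2))) => //.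
- exact: hser_scale_var_reg.
- exact: hser_reduction.
- exact: hser_reduction.
- exact: hser_reduction.
(* At coefficient 0 the correction sum ranges over [1 <= j < 1] and is empty, leaving [diff R 0]. *)
- by move=> w; apply: etrans (D1E w 0%N) _; rewrite big_geq ?addr0.
- by move=> w; apply: etrans (D2E w 0%N) _; rewrite big_geq ?addr0.
Qed.
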